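(* Let $V=\{1,\dots,n\}$ with $n\ge1$, let $w\in\mathbb{R}^n$ have all $w_i>0$, let $f:2^V\to\mathbb{R}$ be a non-decreasing submodular function with $f(\emptyset)=0$, and let $g:2^V\to\mathbb{R}$ be a non-decreasing supermodular function with $g(\emptyset)=0$. Then the games $\Gamma_{\max}(\mathcal{B}(f),w)$, $\Gamma_{\max}(\mathcal{B}(g),w)$, $\Gamma_{\min}(\mathcal{B}(g),w)$ and $\Gamma_{\min}(\mathcal{B}(f),w)$ have the following solutions (minima and maxima over $S$ are over non-empty $S\subseteq V$; $\zeta\in\mathbb{R}^n$ denotes a vector with all $\zeta_i>0$). (1) $\Gamma_{\max}(\mathcal{B}(f),w)$: the value is $\min_S \frac{f(S)}{w^{-1}(S)}$. If $\mathcal{S}$ is any $f$-$w$ decomposition of $V$, then $x^{\mathcal{S}}$ is optimal for Player 1. The set of optimal Player 2 strategies is the convex hull of the set of $y^{S^*}$, where $S^*$ ranges over all non-empty sets attaining this minimum. If $P_{f,w}$ is $\zeta$-decreasing, then the union $S^*$ of all sets attaining the minimum has the form $\{i\in V:\zeta_i\le r\}$ for some $r>0$. If $P_{f,w}$ is decreasing, then the minimum is attained at $S^*=V$. (2) $\Gamma_{\max}(\mathcal{B}(g),w)$: the value is $\min_S \frac{g^\#(S)}{w^{-1}(S)}$. If $\mathcal{S}$ is any $g^\#$-$w$ decomposition of $V$, then $x^{\mathcal{S}}$ is optimal for Player 1. The set of optimal Player 2 strategies is the convex hull of the set of $y^{S^*}$, where $S^*$ ranges over all non-empty sets attaining this minimum.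 If $P_{g,w}$ is $\zeta$-increasing, then the union $S^*$ of all sets attaining the minimum has the form $\{i\in V:\zeta_i\le r\}$ for some $r>0$. If $P_{g,w}$ is increasing, then the minimum is attained at $S^*=V$. (3) $\Gamma_{\min}(\mathcal{B}(g),w)$: the value is $\max_S \frac{g(S)}{w^{-1}(S)}$. If $\mathcal{S}$ is any $g$-$w$ max-decomposition of $V$, then $x^{\mathcal{S}}$ is optimal for Player 1. The set of optimal Player 2 strategies is the convex hull of the set of $y^{S^*}$, where $S^*$ ranges over all non-empty sets attaining this maximum. If $P_{g,w}$ is $\zeta$-increasing, then the union $S^*$ of all sets attaining the maximum has the form $\{i\in V:\zeta_i\ge r\}$ for some $r>0$. If $P_{g,w}$ is increasing, then the maximum is attained at $S^*=V$. (4) $\Gamma_{\min}(\mathcal{B}(f),w)$: the value is $\max_S \frac{f^\#(S)}{w^{-1}(S)}$. If $\mathcal{S}$ is any $f^\#$-$w$ max-decomposition of $V$, then $x^{\mathcal{S}}$ is optimal for Player 1. The set of optimal Player 2 strategies is the convex hull of the set of $y^{S^*}$, where $S^*$ ranges over all non-empty sets attaining this maximum. If $P_{f,w}$ is $\zeta$-decreasing, then the union $S^*$ of all sets attaining the maximum has the form $\{i\in V:\zeta_i\ge r\}$ for some $r>0$. If $P_{f,w}$ is decreasing, then the maximum is attained at $S^*=V$.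
   Context: For $x\in\mathbb{R}^n$ and $S\subseteq V$, write $x(S)=\sum_{j\in S}x_j$; $w^{-1}(S)=\sum_{i\in S}1/w_i$. Base polyhedra: for submodular $f$, $\mathcal{B}(f)=\{x\in\mathbb{R}^n_+:x(S)\le f(S)\ \forall S\subseteq V,\ x(V)=f(V)\}$; for supermodular $g$, $\mathcal{B}(g)=\{x\in\mathbb{R}^n:x(S)\ge g(S)\ \forall S\subseteq V,\ x(V)=g(V)\}$. For $\phi\in\{f,g\}$, the vertices of $\mathcal{B}(\phi)$ are the points $x^\sigma$, $\sigma$ a permutation of $V$, with $x^\sigma_{\sigma(j)}=\phi(\{\sigma(1),\dots,\sigma(j)\})-\phi(\{\sigma(1),\dots,\sigma(j-1)\})$. The dual of a set function $\phi$ is $\phi^\#(S)=\phi(V)-\phi(V\setminus S)$. Games: for $\phi\in\{f,g\}$, in both $\Gamma_{\max}(\mathcal{B}(\phi),w)$ and $\Gamma_{\min}(\mathcal{B}(\phi),w)$ a pure strategy of Player 1 is a permutation $\sigma$ of $V$ (equivalently a vertex $x^\sigma$ of $\mathcal{B}(\phi)$), a pure strategy of Player 2 is $j\in V$, and the payoff is $P_{\phi,w}(\sigma,j)=w_jx^\sigma_j$. In $\Gamma_{\max}$ Player 1 maximizes and Player 2 minimizes the payoff; in $\Gamma_{\min}$ Player 1 minimizes and Player 2 maximizes. Mixed strategies of Player 1 are identified with points $x\in\mathcal{B}(\phi)$. Mixed strategies of Player 2 are identified with points of $C=\{\sum_j\theta_jw_je^j:\theta_j\ge0,\sum_j\theta_j=1\}$,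 where $e^j$ is the $j$th coordinate vector. The expected payoff is $x^Ty$. Value and optimal strategies are in the usual minimax sense. For $S\neq\emptyset$, $y^S=\frac{1}{w^{-1}(S)}\sum_{i\in S}e^i\in C$. Decompositions: for a set function $\phi$ on $V$, $T\subseteq V$ and non-empty $S\subseteq V\setminus T$, let $h^{\phi,w}_T(S)=\frac{\phi(T\cup S)-\phi(T)}{w^{-1}(S)}$. Set $S_0=\emptyset$; given $S_0,\dots,S_j$, let $S^j=S_1\cup\dots\cup S_j$ (with $S^0=\emptyset$). If $S^j=V$, set $r=j$ and stop; otherwise let $S_{j+1}$ be any non-empty $S\subseteq V\setminus S^j$ that minimizes (for a $\phi$-$w$ decomposition), respectively maximizes (for a $\phi$-$w$ max-decomposition), $h^{\phi,w}_{S^j}(S)$. For the resulting $\mathcal{S}=(S_1,\dots,S_r)$, the point $x^{\mathcal{S}}$ is given by $x^{\mathcal{S}}_i=w_i^{-1}h^{\phi,w}_{S^{j-1}}(S_j)$ for $i\in S_j$, $j=1,\dots,r$, with $\phi$ the same function as used in the decomposition. Monotonicity: $P=P_{\phi,w}$ is $\zeta$-decreasing (respectively $\zeta$-increasing) if for every permutation $\sigma$ and all $i,j\in V$ with $\sigma^{-1}(i)<\sigma^{-1}(j)$, $\frac{P(\sigma,i)}{P(\sigma,j)}\ge\frac{\zeta_i}{\zeta_j}$ (respectively $\le$), understood in cross-multiplied form $\zeta_jP(\sigma,i)\ge\zeta_iP(\sigma,j)$ (respectively $\le$). $P$ is decreasing (respectively increasing) if this holds with $\zeta_i=1$ for all $i$.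 *)

(* Defs.v *)
From mathcomp Require Import all_boot all_order all_algebra all_fingroup.
From mathcomp Require Import all_classical reals ereal.
(* [set0] and [setT] denote finite sets from here on *)
From mathcomp Require Import finset.
Set Implicit Arguments.
Unset Strict Implicit.
Unset Printing Implicit Defensive.
Import Order.TTheory GRing.Theory Num.Theory.
Local Open Scope ring_scope.

(* V = 'I_n, set functions are functions {set 'I_n} -> R, and points of R^n are
   row vectors. *)

Section SetFunctions.
Context {R : realType} {n : nat}.
Implicit Types (phi f g : {set 'I_n} -> R) (w x y zeta : 'rV[R]_n).
Implicit Types (S T : {set 'I_n}) (s : 'S_n) (D : seq {set 'I_n}).

Definition nondecreasing_fun phi :=
  forall S T, S \subset T -> phi S <= phi T.

Definition submodular f :=
  forall S T, f (S :|: T) + f (S :&: T) <= f S + f T.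

Definition supermodular g :=
  forall S T, g S + g T <= g (S :|: T) + g (S :&: T).

Definition dual phi S : R := phi setT - phi (~: S).

Definition vsum x S : R := \sum_(i in S) x 0 i.

Definition winv w S : R := \sum_(i in S) (w 0 i)^-1.

Definition dot x y : R := \sum_i x 0 i * y 0 i.

Definition base_sub f : set 'rV[R]_n :=
  [set x : 'rV[R]_n | [/\ forall i, 0 <= x 0 i,
               forall S, vsum x S <= f S & vsum x setT = f setT]]%classic.

Definition base_super g : set 'rV[R]_n :=
  [set x : 'rV[R]_n | (forall S, g S <= vsum x S) /\ vsum x setT = g setT]%classic.

(* The permutation s lists V in the order s 0, ..., s (n - 1), so the position
   of i in the list is s^-1 i. *)
Definition vertex phi s : 'rV[R]_n :=
  \row_i (phi [set s k | k : 'I_n & (k <= (s^-1)%g i)%N]%SET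
          - phi [set s k | k : 'I_n & (k < (s^-1)%g i)%N]%SET).

Definition payoff phi w s (j : 'I_n) : R := w 0 j * vertex phi s 0 j.

Definition strategies2 w : set 'rV[R]_n :=
  [set y : 'rV[R]_n | exists theta : 'rV[R]_n,
     [/\ forall j, 0 <= theta 0 j, \sum_j theta 0 j = 1
       & y = \sum_j (theta 0 j * w 0 j) *: delta_mx 0 j]]%classic.

Lemma dot_pure phi w s j :
  dot (vertex phi s) (w 0 j *: delta_mx 0 j) = payoff phi w s j.
Proof.
rewrite /dot /payoff (bigD1 j) //= big1 => [|i /negPf ij]; last first.
  by rewrite !mxE eqxx ij !mulr0.
by rewrite [in X in _ * X]mxE [in X in _ * (_ * X)]mxE !eqxx mulr1 addr0 mulrC.
Qed.

(* Cross-multiplied forms of P(s, i) / P(s, j) >= zeta_i / zeta_j, resp. <=, for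
   i before j in the order s. *)
Definition zeta_decreasing phi w zeta :=
  forall s (i j : 'I_n), ((s^-1)%g i < (s^-1)%g j)%N ->
    zeta 0 i * payoff phi w s j <= zeta 0 j * payoff phi w s i.

Definition zeta_increasing phi w zeta :=
  forall s (i j : 'I_n), ((s^-1)%g i < (s^-1)%g j)%N ->
    zeta 0 j * payoff phi w s i <= zeta 0 i * payoff phi w s j.

Definition payoff_decreasing phi w := zeta_decreasing phi w (const_mx 1).

Definition payoff_increasing phi w := zeta_increasing phi w (const_mx 1).

Definition ratio phi w S : R := phi S / winv w S.

(* For n > 0 the set V itself is among the non-empty S, so that starting the
   iteration from its ratio does not affect the minimum or the maximum. *)
Definition min_ratio phi w : R :=
  \big[Num.min/ratio phi w setT]_(S : {set 'I_n} | S != set0) ratio phi w S.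

Definition max_ratio phi w : R :=
  \big[Num.max/ratio phi w setT]_(S : {set 'I_n} | S != set0) ratio phi w S.

Definition attains_min phi w S : bool :=
  (S != set0) && (ratio phi w S == min_ratio phi w).

Definition attains_max phi w S : bool :=
  (S != set0) && (ratio phi w S == max_ratio phi w).

Definition yvec w S : 'rV[R]_n :=
  (winv w S)^-1 *: \sum_(i in S) delta_mx 0 i.

Definition conv_hull (A : set 'rV[R]_n) : set 'rV[R]_n :=
  [set y : 'rV[R]_n | exists (m : nat) (a : 'I_m -> 'rV[R]_n) (t : 'I_m -> R),
     [/\ forall k, A (a k), forall k, 0 <= t k, \sum_k t k = 1
       & y = \sum_k t k *: a k]]%classic.

Definition hratio phi w T S : R := (phi (T :|: S) - phi T) / winv w S.

(* D is the 0-indexed list of the parts: nth set0 D j is the part of index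
   j + 1, and prefix_union D j is the union of the parts of index at most j. *)
Definition prefix_union D (j : nat) : {set 'I_n} :=
  (\bigcup_(S <- take j D) S)%SET.

Definition is_decomposition phi w D :=
  (forall j, (j < size D)%N ->
     [/\ nth set0 D j != set0,
         nth set0 D j \subset ~: prefix_union D j
       & forall S, S != set0 -> S \subset ~: prefix_union D j ->
           hratio phi w (prefix_union D j) (nth set0 D j)
             <= hratio phi w (prefix_union D j) S])
  /\ prefix_union D (size D) = setT.

Definition is_max_decomposition phi w D :=
  (forall j, (j < size D)%N ->
     [/\ nth set0 D j != set0,
         nth set0 D j \subset ~: prefix_union D j
       & forall S, S != set0 -> S \subset ~: prefix_union D j ->
           hratio phi w (prefix_union D j) S
             <= hratio phi w (prefix_union D j) (nth set0 D j)])
  /\ prefix_union D (size D) = setT.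

Definition decomposition_point phi w D : 'rV[R]_n :=
  \row_i (let j := find (fun S : {set 'I_n} => i \in S) D in
          (w 0 i)^-1 * hratio phi w (prefix_union D j) (nth set0 D j)).

End SetFunctions.

(* A two-person zero-sum game given by its (mixed) strategy sets and expected
   payoff; the maximizer may be either player. *)
Record zero_sum_game (R : realType) (T : Type) := ZeroSumGame {
  maximizer : set T;
  minimizer : set T;
  expected : T -> T -> R  (* maximizer's strategy first *)
}.

Section Games.
Context {R : realType} {T : Type}.
Implicit Types (G : zero_sum_game R T) (x y : T).

Definition worst_max G x : \bar R :=
  ereal_inf [set (expected G x y)%:E | y in minimizer G]%classic.

Definition worst_min G y : \bar R :=
  ereal_sup [set (expected G x y)%:E | x in maximizer G]%classic.

Definition lower_value G : \bar R :=
  ereal_sup [set worst_max G x | x in maximizer G]%classic.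

Definition upper_value G : \bar R :=
  ereal_inf [set worst_min G y | y in minimizer G]%classic.

Definition has_value G (v : R) := lower_value G = v%:E /\ upper_value G = v%:E.

Definition optimal_max G x := maximizer G x /\ worst_max G x = lower_value G.

Definition optimal_min G y := minimizer G y /\ worst_min G y = upper_value G.

End Games.

(* A mixed strategy p of Player 1 is identified with the point
   \sum_s p s *: vertex phi s of the base polyhedron B, and a mixed strategy
   theta of Player 2 with \sum_j (theta_j * w_j) e^j; by dot_pure the expected
   payoff is then dot. *)
Definition Gamma_max {R : realType} {n : nat} (B : set 'rV[R]_n)
    (w : 'rV[R]_n) : zero_sum_game R 'rV[R]_n :=
  ZeroSumGame B (strategies2 w) (fun x y => dot x y).

Definition Gamma_min {R : realType} {n : nat} (B : set 'rV[R]_n)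
    (w : 'rV[R]_n) : zero_sum_game R 'rV[R]_n :=
  ZeroSumGame (strategies2 w) B (fun y x => dot x y).

(* Main.v *)
Require Import Defs.
From mathcomp Require Import all_boot all_order all_algebra all_fingroup.
From mathcomp Require Import all_classical reals ereal.
From mathcomp Require Import finset.
From mathcomp Require Import ring lra.
Set Implicit Arguments.
Unset Strict Implicit.
Unset Printing Implicit Defensive.
Import Order.TTheory GRing.Theory Num.Theory.
Local Open Scope ring_scope.

(** All four games are instances of one analysis.  Let [phi] be submodular with
    value 0 at the empty set, monotone or not, and let [base phi] be
    the set of all x with x(S) <= phi(S) for every S and x(V) = phi(V).
    - Monotonicity of f makes the sign constraint of B(f) redundant, so
      B(f) = base f ([base_subE]).
    - Complementing sets turns the lower bounds of B(g) into upper bounds given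
      by the dual, so B(g) = base (dual g) ([base_superE]); reversing
      permutations carries the payoffs of g to those of its dual
      ([dual_order]).
    - B(g) = - base (- g) ([base_superN]), and changing the sign of a payoff
      exchanges the minimizing and the maximizing role.
    The first two facts leave one game of each kind, solved in
    [Gamma_max_solution] and [Gamma_min_solution]; the third lets both of them
    use the same lemmas about a submodular [phi].

    Let v be the largest number with v w^-1(S) <= phi(S) for all non-empty S,
    and call S tight when equality holds.

    Player 1 can secure v.  Along a decomposition the ratios h are
    non-decreasing, because h of the union of two consecutive parts is a mediant
    of their two ratios, and the first ratio is v; hence the decomposition point
    satisfies w_i x_i >= v for all i ([decomposition_point_ge]).  It belongs to
    [base phi] because its increments are dominated by those of [phi] along a
    chain of sets ([base_of_chain]).

    Player 2 can secure v by y^S with S tight, since x . y^S = x(S) / w^-1(S) is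
    at most phi(S) / w^-1(S) = v, and so by all convex combinations of such
    points ([hull_optimal]).  Conversely, let y be optimal, let s list V by
    decreasing y, let T_1, ..., T_n be the initial segments of s, and write
    y = sum_k lambda_k 1_(T_k) with lambda_k >= 0.  The vertex of s earns
    sum_k lambda_k phi(T_k) against y (the greedy value, i.e. the Lovasz
    extension of [phi] at y), while sum_k lambda_k w^-1(T_k) = 1 because y is a
    mixed strategy.  Optimality thus gives
    sum_k lambda_k (phi(T_k) - v w^-1(T_k)) <= 0, where no term is negative.  So
    T_k is tight whenever lambda_k > 0, and y is the convex combination of the
    y^(T_k) with weights lambda_k w^-1(T_k) ([optimal_hull]).

    Finally, tight sets are closed under union, so their union U is tight.  For
    i in U and j outside U, a permutation that lists U \ i, then i, then j gives
    payoff at most v at i and more than v at j ([max_tight_exchange]).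
    Comparing these two payoffs by monotonicity with respect to zeta separates
    zeta_i from zeta_j, in the direction given by the sign of the payoffs. *)

(** * Games with a saddle value *)

Section SaddleValue.
Context {R : realType} {T : Type}.
Variables (G : zero_sum_game R T) (v : R) (x0 y0 : T).
Hypotheses (Gx0 : maximizer G x0) (Gy0 : minimizer G y0).
Hypothesis x0_guarantee : forall y, minimizer G y -> v <= expected G x0 y.
Hypothesis y0_guarantee : forall x, maximizer G x -> expected G x y0 <= v.

(** No strategy does better than v against the opponent's half of the saddle pair,
    so being optimal means nothing more than securing v. *)
Lemma worst_max_le x : maximizer G x -> (worst_max G x <= v%:E)%E.
Proof.
move=> Gx; apply: (@le_trans _ _ (expected G x y0)%:E); last first.
  by rewrite lee_fin y0_guarantee.
by apply: ereal_inf_lbound; exists y0.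
Qed.

Lemma le_worst_min y : minimizer G y -> (v%:E <= worst_min G y)%E.
Proof.
move=> Gy; apply: (@le_trans _ _ (expected G x0 y)%:E).
  by rewrite lee_fin x0_guarantee.
by apply: ereal_sup_ubound; exists x0.
Qed.

Lemma worst_maxE x : maximizer G x ->
  worst_max G x = v%:E <-> forall y, minimizer G y -> v <= expected G x y.
Proof.
move=> Gx; split=> [vE y Gy|xv].
  by rewrite -lee_fin -vE; apply: ereal_inf_lbound; exists y.
apply/eqP; rewrite eq_le worst_max_le //=.
by apply: le_ereal_inf_tmp => _ [y Gy <-]; rewrite lee_fin xv.
Qed.

Lemma worst_minE y : minimizer G y ->
  worst_min G y = v%:E <-> forall x, maximizer G x -> expected G x y <= v.
Proof.
move=> Gy; split=> [vE x Gx|yv].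
  by rewrite -lee_fin -vE; apply: ereal_sup_ubound; exists x.
apply/eqP; rewrite eq_le le_worst_min // andbT.
by apply: ge_ereal_sup => _ [x Gx <-]; rewrite lee_fin yv.
Qed.

Lemma saddle_has_value : has_value G v.
Proof.
split; apply/eqP; rewrite eq_le.
  apply/andP; split.
    by apply: ge_ereal_sup => _ [x Gx <-]; apply: worst_max_le.
  rewrite -(worst_maxE Gx0).2 //.
  by apply: ereal_sup_ubound; exists x0.
apply/andP; split.
  rewrite -(worst_minE Gy0).2 //.
  by apply: ereal_inf_lbound; exists y0.
by apply: le_ereal_inf_tmp => _ [y Gy <-]; apply: le_worst_min.
Qed.

Lemma optimal_maxE x : optimal_max G x <->
  maximizer G x /\ forall y, minimizer G y -> v <= expected G x y.
Proof.
rewrite /optimal_max saddle_has_value.1.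
by split=> -[Gx] /(worst_maxE Gx).
Qed.

Lemma optimal_minE y : optimal_min G y <->
  minimizer G y /\ forall x, maximizer G x -> expected G x y <= v.
Proof.
rewrite /optimal_min saddle_has_value.2.
by split=> -[Gy] /(worst_minE Gy).
Qed.

End SaddleValue.

Section Core.
Context {R : realType} {n : nat}.
Implicit Types (phi f g : {set 'I_n} -> R) (w x y zeta : 'rV[R]_n).
Implicit Types (S T : {set 'I_n}) (s : 'S_n) (D : seq {set 'I_n}).

(** * Linear algebra of strategies *)

Lemma vsum0 x : vsum x set0 = 0.
Proof. exact: big_set0. Qed.

Lemma vsumID x S T : vsum x S = vsum x (S :&: T) + vsum x (S :\: T).
Proof. exact: big_setID. Qed.

Lemma vsumC x S : vsum x setT = vsum x S + vsum x (~: S).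
Proof. by rewrite (vsumID _ _ S) setTI setTD. Qed.

Lemma vsumN x S : vsum (- x) S = - vsum x S.
Proof. by rewrite /vsum -sumrN; apply: eq_bigr => i _; rewrite mxE. Qed.

Lemma dotNl x y : dot (- x) y = - dot x y.
Proof.
by rewrite /dot -sumrN; apply: eq_bigr => i _; rewrite mxE mulNr.
Qed.

Lemma dotC x y : dot x y = dot y x.
Proof. by apply: eq_bigr => i _; rewrite mulrC. Qed.

Lemma dot_delta x (i : 'I_n) : dot (delta_mx 0 i) x = x 0 i.
Proof.
rewrite /dot (bigD1 i) //= big1 => [|j /negPf ij]; last first.
  by rewrite mxE eqxx ij mul0r.
by rewrite mxE !eqxx mul1r addr0.
Qed.

Lemma winv_gt0 w S : (forall i, 0 < w 0 i) -> S != set0 -> 0 < winv w S.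
Proof.
move=> w_gt0 /set0Pn[i iS]; rewrite /winv (bigD1 i) //=.
rewrite ltr_wpDr ?invr_gt0 //.
by apply: sumr_ge0 => j _; rewrite invr_ge0 ltW.
Qed.

(** The weights theta are recovered as y_i / w_i, which turns membership in the
    strategy set into a normalization that is linear in y. *)
Lemma strategies2P w y : (forall i, 0 < w 0 i) ->
  strategies2 w y <-> (forall i, 0 <= y 0 i) /\ \sum_i y 0 i / w 0 i = 1.
Proof.
move=> w_gt0.
have w_neq0 i : w 0 i != 0 by rewrite gt_eqF.
have sumE (a : 'I_n -> R) i :
    (\sum_j a j *: delta_mx 0 j : 'rV[R]_n) 0 i = a i.
  rewrite summxE (bigD1 i) //= big1 => [|j /negPf ij]; last first.
    by rewrite !mxE eqxx eq_sym ij mulr0.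
  by rewrite !mxE !eqxx mulr1 addr0.
split=> [[theta [theta_ge0 theta1 ->]]|[y_ge0 y1]].
  split=> [i|]; first by rewrite sumE mulr_ge0 // ltW.
  by rewrite -theta1; apply: eq_bigr => i _; rewrite sumE mulfK.
exists (\row_i (y 0 i / w 0 i)); split=> [j||].
- by rewrite mxE divr_ge0 // ltW.
- by rewrite -y1; apply: eq_bigr => j _; rewrite mxE.
- by apply/rowP => i; rewrite sumE mxE divfK.
Qed.

Lemma yvecE w S i : yvec w S 0 i = (winv w S)^-1 * (i \in S)%:R.
Proof.
rewrite /yvec mxE summxE; congr (_ * _).
under eq_bigr do rewrite mxE eqxx /=.
have [iS|iS] := boolP (i \in S).
  rewrite (bigD1 i) //= eqxx big1 ?addr0 // => j /andP[_ /negPf].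
  by rewrite eq_sym => ->.
rewrite big1 // => j jS; case: eqP => // ij.
by rewrite ij jS in iS.
Qed.

Lemma dot_yvec w x S : dot x (yvec w S) = vsum x S / winv w S.
Proof.
rewrite /dot /vsum mulrC mulr_sumr [RHS]big_mkcond /=.
apply: eq_bigr => i _; rewrite yvecE.
by case: (i \in S); rewrite ?mulr1 ?mulr0 // mulrC.
Qed.

Lemma yvec_strategy w S : (forall i, 0 < w 0 i) -> S != set0 ->
  strategies2 w (yvec w S).
Proof.
move=> w_gt0 S0; apply/strategies2P => //.
have wS := winv_gt0 w_gt0 S0.
split=> [i|].
  by rewrite yvecE mulr_ge0 ?invr_ge0 ?(ltW wS).
rewrite -(divff (lt0r_neq0 wS)) {2}/winv mulrC mulr_sumr [RHS]big_mkcond /=.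
apply: eq_bigr => i _; rewrite yvecE.
by case: (i \in S); rewrite ?mulr1 ?mulr0 // mul0r.
Qed.

(** * The base polytope *)

Definition base phi : set 'rV[R]_n :=
  [set x : 'rV[R]_n | (forall S, vsum x S <= phi S)
                      /\ vsum x setT = phi setT]%classic.

(** Submodularity makes increments decrease as sets grow, so an increment of
    [phi] over the full set [T j] is at most the one over [S :&: T j]; summing
    the bounds along the chain gives x(S) <= phi(S).  Vertices and decomposition
    points are both obtained from chains in this way. *)
Lemma base_of_chain phi x (T : nat -> {set 'I_n}) m :
  submodular phi -> phi set0 = 0 -> T 0%N = set0 -> T m = setT ->
  (forall j, (j < m)%N -> T j \subset T j.+1) ->
  (forall j S, (j < m)%N -> S \subset T j.+1 :\: T j ->
     vsum x S <= phi (T j :|: S) - phi (T j)) ->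
  (forall j, (j < m)%N ->
     vsum x (T j.+1 :\: T j) = phi (T j.+1) - phi (T j)) ->
  base phi x.
Proof.
move=> phi_sub phi0 T0 Tm T_mono x_le x_eq.
have le_prefix S j : (j <= m)%N -> vsum x (S :&: T j) <= phi (S :&: T j).
  elim: j => [_|j IHj jm]; first by rewrite T0 setI0 vsum0 phi0.
  rewrite (vsumID _ _ (T j)) -setIA (setIidPr (T_mono _ jm)).
  have {}IHj := IHj (ltnW jm).
  have S'sub : (S :&: T j.+1) :\: T j \subset T j.+1 :\: T j.
    by rewrite setSD ?subsetIr.
  have := x_le j _ jm S'sub.
  have -> : T j :|: (S :&: T j.+1) :\: T j = T j :|: (S :&: T j.+1).
    by apply/setP => i; rewrite !inE; case: (i \in T j).
  have := phi_sub (T j) (S :&: T j.+1).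
  have -> : T j :&: (S :&: T j.+1) = S :&: T j.
    by rewrite setICA (setIidPl (T_mono _ jm)).
  lra.
have eq_prefix j : (j <= m)%N -> vsum x (T j) = phi (T j).
  elim: j => [_|j IHj jm]; first by rewrite T0 vsum0 phi0.
  rewrite (vsumID _ _ (T j)) (setIidPr (T_mono _ jm)) IHj 1?ltnW // x_eq //.
  by rewrite addrC subrK.
split=> [S|]; last by rewrite -Tm eq_prefix.
by have := le_prefix S m (leqnn m); rewrite Tm setIT.
Qed.

(** * Vertices and the greedy algorithm *)

Definition before s (k : nat) : {set 'I_n} := [set l | ((s^-1)%g l < k)%N].

Lemma vertexE phi s i : vertex phi s 0 i =
  phi (before s ((s^-1)%g i).+1) - phi (before s ((s^-1)%g i)).
Proof.
have initE m : [set s k | k : 'I_n & (k < m)%N] = before s m.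
  apply/setP => l; rewrite inE; apply/imsetP/idP => [[k + ->]|lm].
    by rewrite inE permK.
  by exists ((s^-1)%g l); rewrite ?inE ?permKV.
rewrite mxE -!initE; congr (phi _ - phi _).
Qed.

Lemma before0 s : before s 0 = set0.
Proof. by apply/setP => i; rewrite !inE. Qed.

Lemma beforen s : before s n = setT.
Proof. by apply/setP => i; rewrite !inE ltn_ord. Qed.

Lemma beforeS s (k : 'I_n) : before s k.+1 = s k |: before s k.
Proof.
apply/setP => i; rewrite !inE ltnS leq_eqVlt; congr (_ || _).
apply/eqP/eqP => [ik|->]; last by rewrite permK.
by rewrite -[i](permKV s); congr (s _); apply: val_inj.
Qed.

Lemma before_notin s (k : 'I_n) : s k \notin before s k.
Proof. by rewrite inE permK ltnn. Qed.

Lemma vertex_base phi s : submodular phi -> phi set0 = 0 ->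
  base phi (vertex phi s).
Proof.
move=> phi_sub phi0.
have diffE (k : 'I_n) : before s k.+1 :\: before s k = [set s k].
  apply/setP => i; rewrite beforeS !inE.
  by case: eqP => [->|_] /=; rewrite ?permK ?ltnn // andNb.
have vE (k : 'I_n) : vsum (vertex phi s) [set s k]
    = phi (before s k.+1) - phi (before s k).
  by rewrite /vsum big_set1 vertexE permK.
apply: (@base_of_chain _ _ (before s) n) => //.
- exact: beforen.
- move=> j jn; apply/fintype.subsetP => i; rewrite !inE; exact: leqW.
- move=> j S jn; rewrite (diffE (Ordinal jn)) subset1 => /orP[]/eqP->.
    by rewrite vE /= setUC -(beforeS _ (Ordinal jn)).
  by rewrite vsum0 setU0 subrr.
- by move=> j jn; rewrite (diffE (Ordinal jn)) vE.
Qed.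

(** The default 0 beyond the last position makes the last layer equal to the
    last entry, so that layers sum back to the entries of y. *)
Definition entry s y (k : nat) : R :=
  oapp (fun a : 'I_n => y 0 (s a)) 0 (insub k).

Lemma entryE s y (k : 'I_n) : entry s y k = y 0 (s k).
Proof. by rewrite /entry valK. Qed.

Lemma entry_oversize s y : entry s y n = 0.
Proof. by rewrite /entry insubF ?ltnn. Qed.

Definition layer s y (k : nat) : R := entry s y k - entry s y k.+1.

Lemma layer_ge0 s y : (forall i, 0 <= y 0 i) ->
  (forall a b : 'I_n, (a <= b)%N -> y 0 (s b) <= y 0 (s a)) ->
  forall k : 'I_n, 0 <= layer s y k.
Proof.
move=> y_ge0 y_dec k; rewrite /layer entryE /entry.
by case: insubP => [l _ lE|_] /=; rewrite ?subr0 // subr_ge0 y_dec ?lE.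
Qed.

(** Abel summation: the payoff of the vertex of s against y is a combination of
    the values of [phi] on the initial segments of s, and is the Lovasz extension
    of [phi] at y when s sorts y decreasingly. *)
Lemma dot_vertex phi s y : phi set0 = 0 ->
  dot (vertex phi s) y = \sum_(k < n) layer s y k * phi (before s k.+1).
Proof.
move=> phi0.
have abel (F : nat -> R) m : F 0%N = 0 ->
    \sum_(k < m) entry s y k * (F k.+1 - F k)
    = \sum_(k < m) layer s y k * F k.+1 + entry s y m * F m.
  move=> F0; elim: m => [|m IHm]; first by rewrite !big_ord0 F0 mulr0 addr0.
  rewrite !big_ord_recr /= IHm /layer; ring.
have := abel (fun k => phi (before s k)) n; rewrite before0 => /(_ phi0).
rewrite entry_oversize mul0r addr0 => <-.
rewrite /dot (reindex_inj (@perm_inj _ s)) /=.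
by apply: eq_bigr => k _; rewrite vertexE permK mulrC entryE.
Qed.

Lemma vertex_vsum x s : vertex (vsum x) s = x.
Proof.
apply/rowP => i; rewrite vertexE beforeS /vsum big_setU1 ?before_notin //=.
by rewrite permKV addrK.
Qed.

(** The greedy formula for an additive set function, whose vertices all coincide.
    Applied to inverse weights and to unit vectors, it decomposes both the
    normalization of y and y itself along the same chain. *)
Lemma dot_layers x s y :
  dot x y = \sum_(k < n) layer s y k * vsum x (before s k.+1).
Proof. by rewrite -{1}(vertex_vsum x s) dot_vertex ?vsum0. Qed.

Lemma sorting_perm (key : 'I_n -> R) :
  exists s, forall a b : 'I_n, (a <= b)%N -> key (s a) <= key (s b).
Proof.
pose leK := relpre key <=%R.
have leK_total : total leK by move=> i j; apply: le_total.
have leK_trans : transitive leK by move=> j i k; apply: le_trans.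
have leK_refl : reflexive leK by move=> i; rewrite /leK /=.
have : perm_eq (sort leK (ord_tuple n)) (ord_tuple n) by rewrite perm_sort.
move=> /tuple_permP[s sE]; exists s => a b ab.
have nthE (i : 'I_n) : nth a (sort leK (ord_tuple n)) i = s i.
  by rewrite sE -tnth_nth tnth_mktuple tnth_ord_tuple.
have szE : size (sort leK (ord_tuple n)) = n by rewrite size_sort size_tuple.
rewrite -!nthE; apply: (sorted_leq_nth leK_trans leK_refl) => //.
- exact: sort_sorted.
- by rewrite inE szE.
- by rewrite inE szE.
Qed.

(** * Decompositions *)

Lemma prefix_unionS D j : (j < size D)%N ->
  prefix_union D j.+1 = prefix_union D j :|: nth set0 D j.
Proof.
by move=> jD; rewrite /prefix_union (take_nth set0) // -cats1 big_cat big_seq1.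
Qed.

Lemma prefix_union0 D : prefix_union D 0 = set0.
Proof. by rewrite /prefix_union take0 big_nil. Qed.

Lemma nth_sub_prefix D j k : (k < j)%N -> (j <= size D)%N ->
  nth set0 D k \subset prefix_union D j.
Proof.
elim: j => // j IHj kj jD; rewrite prefix_unionS //.
move: kj; rewrite ltnS leq_eqVlt => /orP[/eqP->|kj]; first exact: subsetUr.
exact: fintype.subset_trans (IHj kj (ltnW jD)) (subsetUl _ _).
Qed.

Lemma prefix_unionP D i j : (j <= size D)%N -> i \in prefix_union D j ->
  exists2 k, (k < j)%N & i \in nth set0 D k.
Proof.
elim: j => [|j IHj] jD; first by rewrite prefix_union0 inE.
rewrite prefix_unionS // inE => /orP[/(IHj (ltnW jD))[k kj ik]|ij].
  by exists k => //; apply: ltnW.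
by exists j.
Qed.

Lemma decomposition_pointE phi w D j i : (j < size D)%N ->
  nth set0 D j \subset ~: prefix_union D j -> i \in nth set0 D j ->
  decomposition_point phi w D 0 i
    = (w 0 i)^-1 * hratio phi w (prefix_union D j) (nth set0 D j).
Proof.
move=> jD D_disj ij; rewrite mxE.
suff -> : find (fun S : {set 'I_n} => i \in S) D = j by [].
have iD : has (fun S : {set 'I_n} => i \in S) D.
  by apply/hasP; exists (nth set0 D j) => //; apply: mem_nth.
have := nth_find set0 iD; set k := find _ _ => ik.
apply/eqP. rewrite eqn_leq leqNgt. apply/andP; split.
  by apply/negP => /(before_find set0); rewrite ij.
rewrite leqNgt; apply/negP => /nth_sub_prefix/(_ (ltnW jD)).
move=> /fintype.subsetP/(_ _ ik) iP.
by move: (fintype.subsetP D_disj _ ij); rewrite inE iP.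
Qed.

Section Positive.
Variable w : 'rV[R]_n.
Hypothesis w_gt0 : forall i, 0 < w 0 i.

Lemma winv0 : winv w set0 = 0.
Proof. exact: big_set0. Qed.

Lemma winvU S T : T \subset ~: S -> winv w (S :|: T) = winv w S + winv w T.
Proof.
move=> ST; rewrite /winv (big_setID S) /= setUK setDUl setDv set0U.
by congr (_ + _); rewrite setDE (setIidPl ST).
Qed.

Lemma hratioE phi T S : S != set0 ->
  hratio phi w T S * winv w S = phi (T :|: S) - phi T.
Proof. by move=> S0; rewrite divfK // gt_eqF // winv_gt0. Qed.

Lemma le_hratio phi T S h : S != set0 ->
  (h <= hratio phi w T S) = (h * winv w S <= phi (T :|: S) - phi T).
Proof. by move=> S0; rewrite ler_pdivlMr // winv_gt0. Qed.

Lemma vsum_decomposition_point phi D j S : (j < size D)%N ->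
  nth set0 D j \subset ~: prefix_union D j -> S \subset nth set0 D j ->
  vsum (decomposition_point phi w D) S
    = hratio phi w (prefix_union D j) (nth set0 D j) * winv w S.
Proof.
move=> jD D_disj SD; rewrite /vsum /winv mulr_sumr; apply: eq_bigr => i iS.
by rewrite (decomposition_pointE phi w jD D_disj) 1?mulrC // (fintype.subsetP SD).
Qed.

(** Minimality of the ratio of each part is exactly the increment bound that the
    chain of prefix unions has to satisfy. *)
Lemma decomposition_base phi D : submodular phi -> phi set0 = 0 ->
  is_decomposition phi w D -> base phi (decomposition_point phi w D).
Proof.
move=> phi_sub phi0 [D_min D_cover].
have diffE j : (j < size D)%N ->
    prefix_union D j.+1 :\: prefix_union D j = nth set0 D j.
  move=> jD; have [_ D_disj _] := D_min j jD.
  by rewrite prefix_unionS // setDUl setDv set0U setDE (setIidPl D_disj).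
apply: (@base_of_chain _ _ (prefix_union D) (size D)) => //.
- exact: prefix_union0.
- by move=> j jD; rewrite prefix_unionS ?subsetUl.
- move=> j S jD; rewrite diffE // => SD.
  have [_ D_disj hmin] := D_min j jD.
  rewrite (vsum_decomposition_point phi jD) //.
  have [->|S0] := eqVneq S set0; first by rewrite winv0 mulr0 setU0 subrr.
  by rewrite -le_hratio ?hmin // (fintype.subset_trans SD).
- move=> j jD; have [Dj0 D_disj _] := D_min j jD.
  rewrite diffE // (vsum_decomposition_point phi jD) //.
  by rewrite hratioE // -prefix_unionS.
Qed.

(** Any initial stretch of a decomposition can be completed, since an optimal next
    part exists as long as V is not covered. *)
Lemma decomposition_extend phi D :
  (forall j, (j < size D)%N ->
     [/\ nth set0 D j != set0,
         nth set0 D j \subset ~: prefix_union D j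
       & forall S, S != set0 -> S \subset ~: prefix_union D j ->
           hratio phi w (prefix_union D j) (nth set0 D j)
             <= hratio phi w (prefix_union D j) S]) ->
  exists D', is_decomposition phi w D'.
Proof.
have [m] := ubnP #|~: prefix_union D (size D)|.
elim: m D => // m IHm D; set T := prefix_union D (size D) => T_m D_min.
have [T_full|T_proper] := eqVneq (~: T) set0.
  by exists D; split=> //; rewrite -/T -[T]setCK T_full setC0.
have cand : (~: T != set0) && (~: T \subset ~: T) by rewrite T_proper /=.
pose S := [arg min_(S < ~: T | (S != set0) && (S \subset ~: T))
             hratio phi w T S]%O.
have [S0 ST S_min] : [/\ S != set0, S \subset ~: T
    & forall S', S' != set0 -> S' \subset ~: T ->
        hratio phi w T S <= hratio phi w T S'].
  rewrite /S; case: arg_minP => // S' /andP[S'0 S'T] S'_min.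
  by split=> // S'' S''0 S''T; apply: S'_min; rewrite S''0.
have prefE j : (j <= size D)%N ->
    prefix_union (rcons D S) j = prefix_union D j.
  by move=> jD; rewrite /prefix_union -cats1 takel_cat.
apply: (IHm (rcons D S)) => [|j].
  have -> : prefix_union (rcons D S) (size (rcons D S)) = T :|: S.
    rewrite size_rcons prefix_unionS ?size_rcons // prefE //.
    by rewrite nth_rcons ltnn eqxx.
  move: T_m; rewrite ltnS; apply: leq_trans; apply: proper_card.
  have /set0Pn[i iS] := S0; have := fintype.subsetP ST _ iS; rewrite inE => iT.
  apply/fintype.properP; split; first by rewrite setCS subsetUl.
  by exists i; rewrite !inE ?iT // iS orbT.
rewrite size_rcons ltnS => jD; rewrite prefE // nth_rcons.
have [jltD|] := ltnP j (size D); first exact: D_min.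
move=> Dj; have -> : j = size D by apply/eqP; rewrite eqn_leq jD.
by rewrite eqxx.
Qed.

Lemma decomposition_exists phi : exists D, is_decomposition phi w D.
Proof. by apply: (@decomposition_extend phi [::]) => j; rewrite ltn0. Qed.

(** * Sets attaining the bound *)

Definition lower_bound phi v := forall S, S != set0 -> v * winv w S <= phi S.

Definition tight phi v S := (S != set0) && (phi S == v * winv w S).

(** The ratio of the union of two consecutive parts is a mediant of their ratios;
    as the earlier part was chosen to be minimal, the later ratio cannot be
    smaller.  The first ratio is at least v by hypothesis. *)
Lemma decomposition_hratio_ge phi v D j : phi set0 = 0 -> lower_bound phi v ->
  is_decomposition phi w D -> (j < size D)%N ->
  v <= hratio phi w (prefix_union D j) (nth set0 D j).
Proof.
move=> phi0 phi_lb [D_min _]; elim: j => [|j IHj] jD.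
  have [D0 _ _] := D_min 0%N jD.
  by rewrite le_hratio // prefix_union0 set0U phi0 subr0 phi_lb.
have [S0 ST S_min] := D_min j (ltnW jD).
apply: le_trans (IHj (ltnW jD)) _.
have [S'0 S'T _] := D_min j.+1 jD; move: S'T; rewrite le_hratio //.
rewrite prefix_unionS ?(ltnW jD) // setCU subsetI => /andP[S'T S'S].
have := S_min (nth set0 D j :|: nth set0 D j.+1).
rewrite -subset0 subUset subset0 negb_and S0 subUset ST S'T => /(_ isT isT).
rewrite le_hratio; last by rewrite -subset0 subUset subset0 negb_and S0.
rewrite winvU // setUA mulrDr hratioE //; lra.
Qed.

Lemma decomposition_point_ge phi v D i : phi set0 = 0 -> lower_bound phi v ->
  is_decomposition phi w D -> v <= w 0 i * decomposition_point phi w D 0 i.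
Proof.
move=> phi0 phi_lb D_dec; have [D_min D_cover] := D_dec.
have [j jD ij] : exists2 j, (j < size D)%N & i \in nth set0 D j.
  by apply: (prefix_unionP (leqnn _)); rewrite D_cover inE.
have [_ D_disj _] := D_min j jD.
rewrite (decomposition_pointE phi w jD D_disj ij) mulVKf ?gt_eqF //.
exact: decomposition_hratio_ge.
Qed.

(** The excess phi(S) - v w^-1(S) is submodular and non-negative, so its zeros are
    closed under union. *)
Lemma tight_setU phi v S T : submodular phi -> lower_bound phi v ->
  phi set0 = 0 -> tight phi v S -> tight phi v T -> tight phi v (S :|: T).
Proof.
move=> phi_sub phi_lb phi0 /andP[S0 /eqP Sv] /andP[T0 /eqP Tv].
have ST0 : S :|: T != set0 by rewrite -subset0 subUset subset0 negb_and S0.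
have winvID : winv w (S :|: T) + winv w (S :&: T) = winv w S + winv w T.
  have -> : S :|: T = S :|: (T :\: S).
    by apply/setP => i; rewrite !inE; case: (i \in S).
  rewrite winvU ?setDE ?subsetIr // -setDE.
  have -> : winv w T = winv w (T :&: S) + winv w (T :\: S) by apply: big_setID.
  by rewrite setIC -addrA [X in _ + X]addrC.
have capv : v * winv w (S :&: T) <= phi (S :&: T).
  have [->|] := eqVneq (S :&: T) set0; first by rewrite winv0 phi0 mulr0.
  exact: phi_lb.
rewrite /tight ST0 eq_le phi_lb // andbT /=.
have := phi_sub S T; rewrite Sv Tv -mulrDr -winvID mulrDr; lra.
Qed.

Definition max_tight phi v : {set 'I_n} := \bigcup_(S | tight phi v S) S.

Lemma sub_max_tight phi v S : tight phi v S -> S \subset max_tight phi v.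
Proof. by move=> St; apply: (bigcup_sup S). Qed.

Lemma tight_max_tight phi v S0 : submodular phi -> lower_bound phi v ->
  phi set0 = 0 -> tight phi v S0 -> tight phi v (max_tight phi v).
Proof.
move=> phi_sub phi_lb phi0 S0t.
have : (max_tight phi v == set0) || tight phi v (max_tight phi v).
  (* The empty set is kept as an alternative to serve as neutral element. *)
  apply: (big_ind (fun S => (S == set0) || tight phi v S)).
  - by rewrite eqxx.
  - move=> S T /orP[/eqP->|St] /orP[/eqP->|Tt]; rewrite ?set0U ?setU0 ?eqxx //.
    + by rewrite Tt orbT.
    + by rewrite St orbT.
    + by rewrite tight_setU ?orbT.
  - by move=> S ->; rewrite orbT.
case/orP => // /eqP U0; have := sub_max_tight S0t.
by case/andP: S0t => /negPf S0n _; rewrite U0 subset0 S0n.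
Qed.

(** A key that singles out l determines the set listed before l, however ties among
    the other keys are broken. *)
Lemma before_sorted (key : 'I_n -> R) s l :
  (forall a b : 'I_n, (a <= b)%N -> key (s a) <= key (s b)) ->
  (forall k, key k = key l -> k = l) ->
  before s ((s^-1)%g l) = [set k | key k < key l].
Proof.
move=> s_key l_uniq; apply/setP => k; rewrite !inE; apply/idP/idP => [kl|].
  have := s_key _ _ (ltnW kl); rewrite !permKV lt_neqAle => ->; rewrite andbT.
  by apply: contraTneq kl => /l_uniq ->; rewrite ltnn.
by apply: contraTT; rewrite -leqNgt -leNgt => /s_key; rewrite !permKV.
Qed.

(** Removing i from the largest tight set U leaves a set of non-negative excess,
    so i earns at most v when it completes U; adding j leaves the tight sets, so
    j earns more than v right after U.  The two resulting inequalities order zeta_i and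
    zeta_j in one way if the payoffs are non-negative, as for a monotone [phi],
    and in the other way if they are non-positive, as for the opposite of a
    monotone function. *)
Lemma max_tight_exchange phi v zeta i j : submodular phi ->
  lower_bound phi v -> phi set0 = 0 -> zeta_decreasing phi w zeta ->
  i \in max_tight phi v -> j \notin max_tight phi v ->
  exists s, payoff phi w s i < payoff phi w s j /\
    zeta 0 i * payoff phi w s j <= zeta 0 j * payoff phi w s i.
Proof.
move=> phi_sub phi_lb phi0 phi_zeta iU jU; set U := max_tight phi v in iU jU.
have Ut : tight phi v U.
  have /bigcupP[S St _] := iU; exact: (tight_max_tight phi_sub _ _ St).
have /andP[U0 /eqP Uv] := Ut.
have ij : i != j by apply: contraNneq jU => <-.
(* Any sorting by this key lists U \ i, i, j and then the other elements. *)
pose key (l : 'I_n) : R :=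
  if l == i then 1 else if l == j then 2 else if l \in U then 0 else 3.
have [s s_key] := sorting_perm key.
have ji : j != i by rewrite eq_sym.
have keyi : key i = 1 by rewrite /key eqxx.
have keyj : key j = 2 by rewrite /key (negPf ji) eqxx.
have beforej : before s ((s^-1)%g j) = U.
  rewrite (before_sorted s_key) => [|k].
    apply/setP => k; rewrite inE keyj /key.
    case: eqP => [->|_]; first by rewrite iU ltr1n.
    case: eqP => [->|_]; first by rewrite (negPf jU) ltxx.
    by case: (k \in U); apply/idP; lra.
  rewrite keyj /key; case: eqP => [_|_]; first by move=> ?; exfalso; lra.
  by case: eqP => [->|_] //; case: (k \in U) => ?; exfalso; lra.
have beforei : before s ((s^-1)%g i) = U :\ i.
  rewrite (before_sorted s_key) => [|k].
    apply/setP => k; rewrite !inE keyi /key.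
    case: eqP => [->|_] /=; first by rewrite ltxx.
    case: eqP => [->|_]; first by rewrite (negPf jU); apply/idP; lra.
    by case: (k \in U); apply/idP; lra.
  rewrite keyi /key; case: eqP => [->|_] //.
  by case: eqP => [_|_]; last case: (k \in U); move=> ?; exfalso; lra.
have payoffE l : payoff phi w s l
    = w 0 l * (phi (l |: before s ((s^-1)%g l)) - phi (before s ((s^-1)%g l))).
  by rewrite /payoff vertexE beforeS permKV.
have winv_set1 l : winv w [set l] = (w 0 l)^-1 by rewrite /winv big_set1.
exists s; split; last first.
  apply: phi_zeta; rewrite ltnNge; apply/negP => /s_key.
  by rewrite !permKV keyi keyj; apply/negP; rewrite -ltNge ltr1n.
apply: (@le_lt_trans _ _ v).
  rewrite payoffE beforei setD1K // mulrC -ler_pdivlMr // Uv.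
  have -> : winv w U = (w 0 i)^-1 + winv w (U :\ i).
    by rewrite -winv_set1 -winvU ?setD1K // setDE subsetIr.
  have : v * winv w (U :\ i) <= phi (U :\ i).
    have [->|] := eqVneq (U :\ i) set0; first by rewrite winv0 phi0 mulr0.
    exact: phi_lb.
  rewrite mulrDr; lra.
rewrite payoffE beforej mulrC -ltr_pdivrMr // Uv.
have jU0 : j |: U != set0 by apply/set0Pn; exists j; rewrite setU11.
have : v * winv w (j |: U) < phi (j |: U).
  rewrite lt_neqAle phi_lb // andbT; apply: contra jU => /eqP jUv.
  have /sub_max_tight/fintype.subsetP : tight phi v (j |: U).
    by rewrite /tight jU0 jUv eqxx.
  by apply; rewrite setU11.
rewrite winvU ?winv_set1; last first.
  apply/fintype.subsetP => k kU; rewrite !inE.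
  by apply: contraNneq jU => <-.
rewrite mulrDr; lra.
Qed.

(** * The two players' optima *)

(** The payoff is the average of the w_i x_i with weights y_i / w_i. *)
Lemma guarantee v x y : (forall i, v <= w 0 i * x 0 i) -> strategies2 w y ->
  v <= dot x y.
Proof.
move=> x_ge /(strategies2P _ w_gt0)[y_ge0 y1].
rewrite -[v]mulr1 -y1 mulr_sumr; apply: ler_sum => i _.
have -> : x 0 i * y 0 i = (w 0 i * x 0 i) * (y 0 i / w 0 i).
  by field; rewrite gt_eqF.
by rewrite ler_wpM2r ?divr_ge0 // ltW.
Qed.

Lemma hull_optimal phi v x y : base phi x ->
  conv_hull [set yvec w S | S in [set S | tight phi v S]]%classic y ->
  dot x y <= v.
Proof.
move=> [x_le _] [m [a [t [a_tight t_ge0 t1 ->]]]].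
have -> : dot x (\sum_k t k *: a k) = \sum_k t k * dot x (a k).
  rewrite /dot; under [RHS]eq_bigr do rewrite mulr_sumr.
  rewrite [RHS]exchange_big /=; apply: eq_bigr => i _.
  by rewrite summxE mulr_sumr; apply: eq_bigr => k _; rewrite mxE mulrCA.
rewrite -[v]mulr1 -t1 mulr_sumr; apply: ler_sum => k _.
rewrite mulrC ler_wpM2r //; have [S /= /andP[S0 /eqP Sv] <-] := a_tight k.
by rewrite dot_yvec ler_pdivrMr ?winv_gt0 // -Sv.
Qed.

Lemma hull_strategy phi v y :
  conv_hull [set yvec w S | S in [set S | tight phi v S]]%classic y ->
  strategies2 w y.
Proof.
move=> [m [a [t [a_tight t_ge0 t1 ->]]]].
have a_strat k : (forall i, 0 <= a k 0 i) /\ \sum_i a k 0 i / w 0 i = 1.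
  have [S /= /andP[S0 _] <-] := a_tight k.
  exact/strategies2P/yvec_strategy.
have yE i : (\sum_k t k *: a k) 0 i = \sum_k t k * a k 0 i.
  by rewrite summxE; apply: eq_bigr => k _; rewrite mxE.
apply/strategies2P => //; split=> [i|].
  by rewrite yE sumr_ge0 // => k _; rewrite mulr_ge0 // (a_strat k).1.
under eq_bigr do rewrite yE mulr_suml.
rewrite exchange_big /= -t1; apply: eq_bigr => k _.
by under eq_bigr do rewrite -mulrA; rewrite -mulr_sumr (a_strat k).2 mulr1.
Qed.

(** Complementary slackness on the initial segments of a permutation sorting y: an
    optimal y can put weight on tight segments only. *)
Lemma optimal_hull phi v S0 y : submodular phi -> phi set0 = 0 ->
  lower_bound phi v -> tight phi v S0 -> strategies2 w y ->
  (forall x, base phi x -> dot x y <= v) ->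
  conv_hull [set yvec w S | S in [set S | tight phi v S]]%classic y.
Proof.
move=> phi_sub phi0 phi_lb S0t /(strategies2P _ w_gt0)[y_ge0 y1] y_opt.
have [s s_key] := sorting_perm (fun i => - y 0 i).
have lam_ge0 : forall k : 'I_n, 0 <= layer s y k.
  by apply: layer_ge0 => // a b /s_key; rewrite lerN2.
pose T (k : nat) := before s k.+1.
have T0 (k : 'I_n) : T k != set0.
  by apply/set0Pn; exists (s k); rewrite /T beforeS setU11.
have winvE S : vsum (\row_i (w 0 i)^-1) S = winv w S.
  by apply: eq_bigr => i _; rewrite mxE.
have lam1 : \sum_(k < n) layer s y k * winv w (T k) = 1.
  under eq_bigr do rewrite -winvE.
  rewrite -dot_layers -y1 dotC.
  by apply: eq_bigr => i _; rewrite mxE.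
have yE i : y 0 i = \sum_(k < n) layer s y k * (i \in T k)%:R.
  rewrite -dot_delta (dot_layers _ s); apply: eq_bigr => k _; congr (_ * _).
  rewrite /vsum; have [iT|iT] := boolP (i \in T k).
    rewrite (bigD1 i) //= mxE !eqxx big1 ?addr0 // => j /andP[_ /negPf ji].
    by rewrite mxE ji andbF.
  rewrite big1 // => j jT; have /negPf ji : j != i by apply: contraTneq jT => ->.
  by rewrite mxE ji andbF.
have excess_ge0 (k : 'I_n) : true ->
    0 <= layer s y k * (phi (T k) - v * winv w (T k)).
  by move=> _; rewrite mulr_ge0 // subr_ge0 phi_lb.
have excess0 : \sum_(k < n) layer s y k * (phi (T k) - v * winv w (T k)) = 0.
  apply/eqP; rewrite eq_le sumr_ge0 // andbT.
  under eq_bigr do rewrite mulrBr mulrCA.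
  rewrite sumrB -mulr_sumr lam1 mulr1 subr_le0 -dot_vertex //.
  by apply/y_opt/vertex_base.
have lam0 (k : 'I_n) : ~~ tight phi v (T k) -> layer s y k = 0.
  move=> kt; have /eqP : layer s y k * (phi (T k) - v * winv w (T k)) = 0.
    exact: (psumr_eq0P excess_ge0 excess0).
  rewrite mulf_eq0 => /orP[/eqP //|]; rewrite subr_eq0 => Tv.
  by rewrite /tight T0 Tv in kt.
(* Segments that are not tight have weight 0; S0 only fills their places. *)
exists n, (fun k => if tight phi v (T k) then yvec w (T k) else yvec w S0).
exists (fun k => layer s y k * winv w (T k)); split=> [k|k||] //.
- by case: ifP => [Tt|_] /=; [exists (T k)|exists S0].
- by rewrite mulr_ge0 // ltW ?winv_gt0.
- apply/rowP => i; rewrite summxE yE; apply: eq_bigr => k _.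
  rewrite mxE; case: ifP => [_|/negbT/lam0->]; last by rewrite !mul0r.
  by rewrite yvecE mulrA mulfK // gt_eqF // winv_gt0.
Qed.

Lemma decomposition_guarantee phi v D y : phi set0 = 0 -> lower_bound phi v ->
  is_decomposition phi w D -> strategies2 w y ->
  v <= dot (decomposition_point phi w D) y.
Proof.
move=> phi0 phi_lb D_dec; apply: guarantee => i.
exact: decomposition_point_ge.
Qed.

Lemma tight_hull phi v S : tight phi v S ->
  conv_hull [set yvec w S | S in [set S | tight phi v S]]%classic (yvec w S).
Proof.
move=> St; exists 1%N, (fun=> yvec w S), (fun=> 1); split=> [_|||] //.
- by exists S.
- by rewrite big_ord1.
- by rewrite big_ord1 scale1r.
Qed.

End Positive.

(** * Duality *)

Lemma dualK phi : phi set0 = 0 -> dual (dual phi) = phi.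
Proof.
move=> phi0; apply/funext => S.
by rewrite /dual setCK setCT phi0 subr0 opprB addrCA subrr addr0.
Qed.

Lemma dual0 phi : dual phi set0 = 0.
Proof. by rewrite /dual setC0 subrr. Qed.

Lemma dual_nondecreasing phi : nondecreasing_fun phi ->
  nondecreasing_fun (dual phi).
Proof. by move=> phi_mono S T ST; rewrite lerD2l lerN2 phi_mono ?setCS. Qed.

Lemma dual_submodular phi : supermodular phi -> submodular (dual phi).
Proof.
move=> phi_super S T; rewrite /dual setCU setCI.
have := phi_super (~: S) (~: T); lra.
Qed.

Lemma dual_supermodular phi : submodular phi -> supermodular (dual phi).
Proof.
move=> phi_sub S T; rewrite /dual setCU setCI.
have := phi_sub (~: S) (~: T); lra.
Qed.

Lemma base_superE g : g set0 = 0 -> base_super g = base (dual g).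
Proof.
move=> g0; have dualT : dual g setT = g setT by rewrite /dual setCT g0 subr0.
rewrite /base /base_super dualT.
apply/seteqP; split=> x /= [x_S xV]; split=> // S.
- by have := x_S (~: S); have := vsumC x S; rewrite /dual xV; lra.
- by have := x_S (~: S); have := vsumC x S; rewrite /dual setCK xV; lra.
Qed.

(** A monotone f forces x_i = f(V) - x(V \ i) >= f(V) - f(V \ i) >= 0. *)
Lemma base_subE f : nondecreasing_fun f -> base_sub f = base f.
Proof.
move=> f_mono; apply/seteqP; split=> x /= [] // x_le xV; split=> // i.
have := x_le (~: [set i]); have := f_mono (~: [set i]) setT (subsetT _).
have := vsumC x [set i]; rewrite {2}/vsum big_set1 xV; lra.
Qed.

(** Complements of initial segments of s are initial segments of the reversal of
    s, so the dual assigns to s the payoffs of the reversed permutation. *)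
Lemma dual_order phi w s : exists s', (forall i, payoff (dual phi) w s i
      = payoff phi w s' i) /\
  forall i j, ((s^-1)%g i < (s^-1)%g j)%N -> ((s'^-1)%g j < (s'^-1)%g i)%N.
Proof.
(* The reversal of s: s' k = s (n - 1 - k). *)
pose s' := (perm (@rev_ord_inj n) * s)%g.
have s'V i : (s'^-1)%g i = rev_ord ((s^-1)%g i).
  by apply: (@perm_inj _ s'); rewrite permKV permM permE rev_ordK permKV.
have rev_lt (a b : 'I_n) : (rev_ord a < rev_ord b)%N = (b < a)%N.
  by rewrite /= ltn_sub2lE // ltnS.
exists s'; split=> [i|i j]; last by rewrite !s'V rev_lt.
have succE : before s' ((s'^-1)%g i).+1 = ~: before s ((s^-1)%g i).
  by apply/setP => k; rewrite !inE !s'V ltnS leqNgt rev_lt.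
have predE : before s' ((s'^-1)%g i) = ~: before s ((s^-1)%g i).+1.
  by apply/setP => k; rewrite !inE !s'V ltnS -ltnNge rev_lt.
rewrite /payoff !vertexE succE predE /dual; congr (_ * _); lra.
Qed.

Lemma dual_zeta_decreasing phi w zeta : zeta_increasing phi w zeta ->
  zeta_decreasing (dual phi) w zeta.
Proof.
move=> phi_inc s i j ij; have [s' [sE s_rev]] := dual_order phi w s.
by rewrite !sE phi_inc ?s_rev.
Qed.

Lemma dual_zeta_increasing phi w zeta : zeta_decreasing phi w zeta ->
  zeta_increasing (dual phi) w zeta.
Proof.
move=> phi_dec s i j ij; have [s' [sE s_rev]] := dual_order phi w s.
by rewrite !sE phi_dec ?s_rev.
Qed.

(** * Negation *)

Definition oppf phi S : R := - phi S.

Lemma base_superN g x : base_super g x <-> base (oppf g) (- x).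
Proof.
rewrite /base /base_super /=; split=> -[x_S xV]; split=> [S|].
- by rewrite vsumN lerN2.
- by rewrite vsumN xV.
- by rewrite -lerN2 -vsumN.
- by apply: oppr_inj; rewrite -vsumN.
Qed.

Lemma payoffN phi w s i : payoff (oppf phi) w s i = - payoff phi w s i.
Proof. by rewrite /payoff !vertexE /oppf; ring. Qed.

Lemma hratioN phi w T S :
  hratio (oppf phi) w T S = - hratio phi w T S.
Proof. by rewrite /hratio /oppf -opprD mulNr. Qed.

Lemma is_max_decompositionN phi w D : is_max_decomposition phi w D ->
  is_decomposition (oppf phi) w D.
Proof.
move=> [D_max D_cover]; split=> // j jD; have [Dj0 DjT Dj_max] := D_max j jD.
by split=> // S S0 ST; rewrite !hratioN lerN2 Dj_max.
Qed.

Lemma decomposition_pointN phi w D :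
  decomposition_point (oppf phi) w D = - decomposition_point phi w D.
Proof. by apply/rowP => i; rewrite !mxE /= hratioN mulrN. Qed.

Lemma payoff_ge0 phi w s i : (forall i, 0 < w 0 i) -> nondecreasing_fun phi ->
  0 <= payoff phi w s i.
Proof.
move=> w_gt0 phi_mono; rewrite /payoff vertexE mulr_ge0 ?(ltW (w_gt0 _)) //.
by rewrite subr_ge0 phi_mono // beforeS subsetUr.
Qed.

(** * Solutions of the games *)

Lemma threshold_le zeta S : (forall i, 0 < zeta 0 i) -> S != set0 ->
  (forall i j, i \in S -> j \notin S -> zeta 0 i < zeta 0 j) ->
  exists2 r : R, 0 < r & S = [set i | zeta 0 i <= r].
Proof.
move=> zeta_gt0 /set0Pn[i0 i0S] S_lt.
case: (@arg_maxP _ R _ i0 (mem S) (fun i => zeta 0 i) i0S) => k kS k_max.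
exists (zeta 0 k) => //; apply/setP => i; rewrite inE.
apply/idP/idP => [/k_max//|]; apply: contraTT => iS.
by rewrite -ltNge S_lt.
Qed.

Lemma threshold_ge zeta S : (forall i, 0 < zeta 0 i) -> S != set0 ->
  (forall i j, i \in S -> j \notin S -> zeta 0 j < zeta 0 i) ->
  exists2 r : R, 0 < r & S = [set i | r <= zeta 0 i].
Proof.
move=> zeta_gt0 /set0Pn[i0 i0S] S_lt.
case: (@arg_minP _ R _ i0 (mem S) (fun i => zeta 0 i) i0S) => k kS k_min.
exists (zeta 0 k) => //; apply/setP => i; rewrite inE.
apply/idP/idP => [/k_min//|]; apply: contraTT => iS.
by rewrite -ltNge S_lt.
Qed.

Lemma setT_neq0 : (0 < n)%N -> [set: 'I_n] != set0.
Proof. by move=> n_gt0; apply/set0Pn; exists (Ordinal n_gt0); rewrite inE. Qed.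

Lemma min_ratioP phi w : (0 < n)%N -> (forall i, 0 < w 0 i) ->
  [/\ lower_bound w phi (min_ratio phi w),
      exists S, tight w phi (min_ratio phi w) S
    & forall S, attains_min phi w S = tight w phi (min_ratio phi w) S].
Proof.
move=> n_gt0 w_gt0; have V0 := setT_neq0 n_gt0.
have attE S : attains_min phi w S = tight w phi (min_ratio phi w) S.
  rewrite /attains_min /tight /Defs.ratio; have [//|S0] := eqVneq S set0.
  have wS0 := lt0r_neq0 (winv_gt0 w_gt0 S0).
  by rewrite /= (can2_eq (divfK wS0) (mulfK wS0)).
split=> // [S S0|].
  rewrite -ler_pdivlMr ?winv_gt0 //.
  exact: (@bigmin_le_cond _ R _ _ S (fun S => S != set0) (Defs.ratio phi w) S0).
have : exists2 S, S != set0 & Defs.ratio phi w S = min_ratio phi w.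
  apply: (big_ind (fun v => exists2 S, S != set0 & Defs.ratio phi w S = v)) =>
    [|_ _ [S S0 <-] [T T0 <-]|S S0].
  - by exists setT.
  - by case: (leP (Defs.ratio phi w S) (Defs.ratio phi w T)) => _; [exists S|exists T].
  - by exists S.
by case=> S S0 SE; exists S; rewrite -attE /attains_min S0 SE eqxx.
Qed.

(** The maximal ratio is the opposite of the minimal ratio of [- phi], and the same
    sets attain both. *)
Lemma max_ratioP phi w : (0 < n)%N -> (forall i, 0 < w 0 i) ->
  [/\ lower_bound w (oppf phi) (- max_ratio phi w),
      exists S, tight w (oppf phi) (- max_ratio phi w) S
    & forall S, attains_max phi w S
        = tight w (oppf phi) (- max_ratio phi w) S].
Proof.
move=> n_gt0 w_gt0.
have ratioN S : Defs.ratio (oppf phi) w S = - Defs.ratio phi w S.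
  by rewrite /Defs.ratio /oppf mulNr.
have minE : min_ratio (oppf phi) w = - max_ratio phi w.
  rewrite /min_ratio /max_ratio (big_morph _ (@oppr_max R) (erefl _)) ratioN.
  by apply: eq_bigr.
have [lb ex attE] := min_ratioP (oppf phi) n_gt0 w_gt0.
rewrite -minE; split=> // S; rewrite -attE /attains_max /attains_min.
by rewrite ratioN minE eqr_opp.
Qed.

Lemma Gamma_max_solution phi w : (0 < n)%N -> (forall i, 0 < w 0 i) ->
  nondecreasing_fun phi -> submodular phi -> phi set0 = 0 ->
  [/\ has_value (Gamma_max (base phi) w) (min_ratio phi w),
      forall D, is_decomposition phi w D ->
        optimal_max (Gamma_max (base phi) w) (decomposition_point phi w D),
      [set y | optimal_min (Gamma_max (base phi) w) y]%classic
        = conv_hull [set yvec w S | S in [set S | attains_min phi w S]]%classic,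
      forall zeta : 'rV[R]_n, (forall i, 0 < zeta 0 i) ->
        zeta_decreasing phi w zeta ->
        exists2 r : R, 0 < r &
          (\bigcup_(S : {set 'I_n} | attains_min phi w S) S)%SET
            = [set i | zeta 0 i <= r]%SET
    & payoff_decreasing phi w -> attains_min phi w setT].
Proof.
move=> n_gt0 w_gt0 phi_mono phi_sub phi0.
have [] := min_ratioP phi n_gt0 w_gt0; set v := min_ratio phi w.
move=> phi_lb [S0 S0t] attE.
have D_guarantee := decomposition_guarantee w_gt0 phi0 phi_lb.
have [D0 D0_dec] := decomposition_exists w phi.
have hullE : [set yvec w S | S in [set S | attains_min phi w S]]%classic
    = [set yvec w S | S in [set S | tight w phi v S]]%classic.
  by under eq_set do rewrite attE.
have S0_hull := tight_hull S0t.
pose G := Gamma_max (base phi) w.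
have D0_base : maximizer G (decomposition_point phi w D0).
  exact: decomposition_base.
have S0_strat : minimizer G (yvec w S0) := hull_strategy w_gt0 S0_hull.
have S0_guarantee x : maximizer G x -> expected G x (yvec w S0) <= v.
  by move=> xB; apply: (hull_optimal w_gt0 xB S0_hull).
have unionE : (\bigcup_(S : {set 'I_n} | attains_min phi w S) S)%SET
    = max_tight w phi v by apply: eq_bigl.
have U_t := tight_max_tight phi_sub phi_lb phi0 S0t.
have zetaP zeta : (forall i, 0 < zeta 0 i) -> zeta_decreasing phi w zeta ->
    forall i j, i \in max_tight w phi v -> j \notin max_tight w phi v ->
      zeta 0 i < zeta 0 j.
  move=> zeta_gt0 phi_zeta i j iU jU.
  have [s [lt_ij]] := max_tight_exchange w_gt0 phi_sub phi_lb phi0 phi_zeta iU jU.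
  have i_ge0 := payoff_ge0 s i w_gt0 phi_mono.
  rewrite ltNge => zle; apply/negP => z_ji; move: zle; apply/negP.
  rewrite -ltNge; apply: (@le_lt_trans _ _ (zeta 0 i * payoff phi w s i)).
    by rewrite ler_wpM2r.
  by rewrite ltr_pM2l.
have D0_guarantee y : minimizer G y ->
    v <= expected G (decomposition_point phi w D0) y.
  exact: D_guarantee.
split.
- exact: (saddle_has_value D0_base S0_strat).
- move=> D D_dec.
  apply/(optimal_maxE D0_base S0_strat D0_guarantee S0_guarantee).
  by split=> [|y]; [apply: decomposition_base|apply: D_guarantee].
- have optE := optimal_minE D0_base S0_strat D0_guarantee S0_guarantee.
  rewrite hullE; apply/seteqP; split=> y /=.
    by move=> /optE[y_strat y_opt]; apply: (optimal_hull w_gt0 _ _ _ S0t).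
  move=> y_hull; apply/optE; split; first exact: hull_strategy y_hull.
  by move=> x xB; apply: hull_optimal xB y_hull.
- move=> zeta zeta_gt0 phi_zeta; rewrite unionE.
  apply: threshold_le => //; first by case/andP: U_t.
  exact: zetaP.
- move=> /zetaP U_lt; rewrite attE.
  suff <- : max_tight w phi v = setT by [].
  have /andP[/set0Pn[i iU] _] := U_t.
  apply/setP => j; rewrite inE; apply/negbNE/negP => jU.
  have one_gt0 k : 0 < (const_mx 1 : 'rV[R]_n) 0 k by rewrite mxE.
  by have := U_lt one_gt0 i j iU jU; rewrite !mxE ltxx.
Qed.

Lemma Gamma_min_solution g w : (0 < n)%N -> (forall i, 0 < w 0 i) ->
  nondecreasing_fun g -> supermodular g -> g set0 = 0 ->
  [/\ has_value (Gamma_min (base_super g) w) (max_ratio g w),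
      forall D, is_max_decomposition g w D ->
        optimal_min (Gamma_min (base_super g) w) (decomposition_point g w D),
      [set y | optimal_max (Gamma_min (base_super g) w) y]%classic
        = conv_hull [set yvec w S | S in [set S | attains_max g w S]]%classic,
      forall zeta : 'rV[R]_n, (forall i, 0 < zeta 0 i) ->
        zeta_increasing g w zeta ->
        exists2 r : R, 0 < r &
          (\bigcup_(S : {set 'I_n} | attains_max g w S) S)%SET
            = [set i | r <= zeta 0 i]%SET
    & payoff_increasing g w -> attains_max g w setT].
Proof.
move=> n_gt0 w_gt0 g_mono g_super g0.
have [] := max_ratioP g n_gt0 w_gt0; set v := max_ratio g w.
(* Everything below is about [- g], whose bound is [- v]. *)
set phi := oppf g; move=> phi_lb [S0 S0t] attE.
have phi_sub : submodular phi.
  by move=> S T; rewrite /phi /oppf; have := g_super S T; lra.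
have phi0 : phi set0 = 0 by rewrite /phi /oppf g0 oppr0.
have D_guarantee D y : is_decomposition phi w D -> strategies2 w y ->
    dot (- decomposition_point phi w D) y <= v.
  move=> D_dec y_strat; rewrite dotNl lerNl.
  exact: (decomposition_guarantee w_gt0 phi0 phi_lb D_dec).
have D_base D : is_decomposition phi w D ->
    base_super g (- decomposition_point phi w D).
  by move=> D_dec; apply/base_superN; rewrite opprK; apply: decomposition_base.
have hull_guarantee x y : base_super g x ->
    conv_hull [set yvec w S | S in [set S | tight w phi (- v) S]]%classic y ->
    v <= dot x y.
  move=> /base_superN xB y_hull; rewrite -lerN2 -dotNl.
  exact: hull_optimal xB y_hull.
have [D0 D0_dec] := decomposition_exists w phi.
have hullE : [set yvec w S | S in [set S | attains_max g w S]]%classic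
    = [set yvec w S | S in [set S | tight w phi (- v) S]]%classic.
  by under eq_set do rewrite attE.
have S0_hull := tight_hull S0t.
pose G := Gamma_min (base_super g) w.
have D0_base : minimizer G (- decomposition_point phi w D0) := D_base _ D0_dec.
have S0_strat : maximizer G (yvec w S0) := hull_strategy w_gt0 S0_hull.
have S0_guarantee x : minimizer G x -> v <= expected G (yvec w S0) x.
  by move=> xB; exact: (hull_guarantee _ _ xB S0_hull).
have D0_guarantee y : maximizer G y ->
    expected G y (- decomposition_point phi w D0) <= v.
  exact: D_guarantee.
have unionE : (\bigcup_(S : {set 'I_n} | attains_max g w S) S)%SET
    = max_tight w phi (- v) by apply: eq_bigl.
have U_t := tight_max_tight phi_sub phi_lb phi0 S0t.
have zetaP zeta : (forall i, 0 < zeta 0 i) -> zeta_increasing g w zeta ->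
    forall i j, i \in max_tight w phi (- v) -> j \notin max_tight w phi (- v) ->
      zeta 0 j < zeta 0 i.
  move=> zeta_gt0 g_zeta i j iU jU.
  have phi_zeta : zeta_decreasing phi w zeta.
    by move=> s k l /g_zeta; rewrite !payoffN !mulrN lerN2.
  have [s []] := max_tight_exchange w_gt0 phi_sub phi_lb phi0 phi_zeta iU jU.
  rewrite !payoffN ltrN2 !mulrN lerN2 => lt_ji zle.
  have j_ge0 := payoff_ge0 s j w_gt0 g_mono.
  rewrite ltNge; apply/negP => z_ij; move: zle; apply/negP.
  rewrite -ltNge; apply: (@le_lt_trans _ _ (zeta 0 j * payoff g w s j)).
    by rewrite ler_wpM2r.
  by rewrite ltr_pM2l.
split.
- exact: (saddle_has_value S0_strat D0_base).
- move=> D /is_max_decompositionN D_dec.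
  rewrite -[decomposition_point g w D]opprK -decomposition_pointN.
  apply/(optimal_minE S0_strat D0_base S0_guarantee D0_guarantee).
  by split=> [|y]; [apply: D_base|apply: D_guarantee].
- have optE := optimal_maxE S0_strat D0_base S0_guarantee D0_guarantee.
  rewrite hullE; apply/seteqP; split=> y /=.
    move=> /optE[y_strat y_opt]; apply: (optimal_hull w_gt0 _ _ _ S0t) => // x xB.
    rewrite -[x]opprK dotNl lerN2; apply: y_opt.
    by apply/base_superN; rewrite opprK.
  move=> y_hull; apply/optE; split; first exact: hull_strategy y_hull.
  by move=> x xB; exact: (hull_guarantee _ _ xB y_hull).
- move=> zeta zeta_gt0 g_zeta; rewrite unionE.
  apply: threshold_ge => //; first by case/andP: U_t.
  exact: zetaP.
- move=> /zetaP U_lt; rewrite attE.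
  suff <- : max_tight w phi (- v) = setT by [].
  have /andP[/set0Pn[i iU] _] := U_t.
  apply/setP => j; rewrite inE; apply/negbNE/negP => jU.
  have one_gt0 k : 0 < (const_mx 1 : 'rV[R]_n) 0 k by rewrite mxE.
  by have := U_lt one_gt0 i j iU jU; rewrite !mxE ltxx.
Qed.

End Core.
Theorem theorem9 (R : realType) (n : nat) (w : 'rV[R]_n)
    (f g : {set 'I_n} -> R)
    (n_gt0 : (0 < n)%N)
    (w_gt0 : forall i, 0 < w 0 i)
    (f_nondecr : nondecreasing_fun f) (f_sub : submodular f)
    (f0 : f set0 = 0)
    (g_nondecr : nondecreasing_fun g) (g_super : supermodular g)
    (g0 : g set0 = 0) :
  [/\
   [/\ has_value (Gamma_max (base_sub f) w) (min_ratio f w),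
       forall D, is_decomposition f w D ->
         optimal_max (Gamma_max (base_sub f) w) (decomposition_point f w D),
       [set y | optimal_min (Gamma_max (base_sub f) w) y]%classic
         = conv_hull [set yvec w S | S in [set S | attains_min f w S]]%classic,
       forall zeta : 'rV[R]_n, (forall i, 0 < zeta 0 i) ->
         zeta_decreasing f w zeta ->
         exists2 r : R, 0 < r &
           (\bigcup_(S : {set 'I_n} | attains_min f w S) S)%SET
             = [set i | zeta 0 i <= r]%SET
     & payoff_decreasing f w -> attains_min f w setT],
   [/\ has_value (Gamma_max (base_super g) w) (min_ratio (dual g) w),
       forall D, is_decomposition (dual g) w D ->
         optimal_max (Gamma_max (base_super g) w)
           (decomposition_point (dual g) w D),
       [set y | optimal_min (Gamma_max (base_super g) w) y]%classic
         = conv_hull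
             [set yvec w S | S in [set S | attains_min (dual g) w S]]%classic,
       forall zeta : 'rV[R]_n, (forall i, 0 < zeta 0 i) ->
         zeta_increasing g w zeta ->
         exists2 r : R, 0 < r &
           (\bigcup_(S : {set 'I_n} | attains_min (dual g) w S) S)%SET
             = [set i | zeta 0 i <= r]%SET
     & payoff_increasing g w -> attains_min (dual g) w setT],
   [/\ has_value (Gamma_min (base_super g) w) (max_ratio g w),
       forall D, is_max_decomposition g w D ->
         optimal_min (Gamma_min (base_super g) w) (decomposition_point g w D),
       [set y | optimal_max (Gamma_min (base_super g) w) y]%classic
         = conv_hull [set yvec w S | S in [set S | attains_max g w S]]%classic,
       forall zeta : 'rV[R]_n, (forall i, 0 < zeta 0 i) ->
         zeta_increasing g w zeta ->
         exists2 r : R, 0 < r &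
           (\bigcup_(S : {set 'I_n} | attains_max g w S) S)%SET
             = [set i | r <= zeta 0 i]%SET
     & payoff_increasing g w -> attains_max g w setT]
   & [/\ has_value (Gamma_min (base_sub f) w) (max_ratio (dual f) w),
       forall D, is_max_decomposition (dual f) w D ->
         optimal_min (Gamma_min (base_sub f) w)
           (decomposition_point (dual f) w D),
       [set y | optimal_max (Gamma_min (base_sub f) w) y]%classic
         = conv_hull
             [set yvec w S | S in [set S | attains_max (dual f) w S]]%classic,
       forall zeta : 'rV[R]_n, (forall i, 0 < zeta 0 i) ->
         zeta_decreasing f w zeta ->
         exists2 r : R, 0 < r &
           (\bigcup_(S : {set 'I_n} | attains_max (dual f) w S) S)%SET
             = [set i | r <= zeta 0 i]%SET
     & payoff_decreasing f w -> attains_max (dual f) w setT]].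
Proof.
have g'_mono := dual_nondecreasing g_nondecr.
have f'_mono := dual_nondecreasing f_nondecr.
have [vg1 og1 hg1 zg1 dg1] :=
  Gamma_max_solution n_gt0 w_gt0 g'_mono (dual_submodular g_super) (dual0 g).
have [vf2 of2 hf2 zf2 df2] :=
  Gamma_min_solution n_gt0 w_gt0 f'_mono (dual_supermodular f_sub) (dual0 f).
have f_sups : base_sub f = base_super (dual f).
  by rewrite base_subE // base_superE ?dual0 // dualK.
split.
- by rewrite base_subE //; apply: Gamma_max_solution.
- rewrite base_superE //; split=> // [zeta zeta_gt0|] g_inc.
    by apply: zg1 => //; apply: dual_zeta_decreasing.
  by apply: dg1; apply: dual_zeta_decreasing.
- exact: Gamma_min_solution.
- rewrite f_sups; split=> // [zeta zeta_gt0|] f_dec.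
    by apply: zf2 => //; apply: dual_zeta_increasing.
  by apply: df2; apply: dual_zeta_increasing.
Qed.
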